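(* There exists $n_0$ such that the following holds for every integer $n \geq n_0$. Let $F$ be any graph on $n$ vertices with no isolated vertices, with minimum degree $\delta(F)=\delta$ and maximum degree $\Delta(F) \leq \sqrt{n}/40$. If $G$ is an $n$-vertex graph containing no subgraph isomorphic to $F$, then $\lambda(G) \leq \lambda(H_{n,\delta})$, with equality if and only if $G \cong H_{n,\delta}$.
   Context: All graphs are finite and simple. $\lambda(G)$ denotes the spectral radius (largest eigenvalue) of the adjacency matrix of $G$. For integers $n>k\geq 1$, $H_{n,k} = K_{k-1} \vee (K_{n-k} \cup K_1)$, i.e. the $n$-vertex graph consisting of a clique on $n-1$ vertices together with one additional vertex adjacent to exactly $k-1$ vertices of the clique; here $\vee$ denotes the join (all edges between the two graphs added) and $\cup$ the disjoint union. *)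

(* Defs.v *)
From HB Require Import structures.
From mathcomp Require Import all_boot all_order all_algebra.
From mathcomp Require Import reals.
Set Implicit Arguments. Unset Strict Implicit. Unset Printing Implicit Defensive.
Import Order.TTheory GRing.Theory Num.Theory.

Definition simple_graph (n : nat) (e : rel 'I_n) : Prop :=
  symmetric e /\ irreflexive e.

Definition degree (n : nat) (e : rel 'I_n) (v : 'I_n) : nat := #|[set u | e v u]|.

(* minimum and maximum degree (for n >= 1; the default n is never reached
   from below / irrelevant for max) *)
Definition min_degree (n : nat) (e : rel 'I_n) : nat :=
  \big[minn/n]_(v : 'I_n) degree e v.
Definition max_degree (n : nat) (e : rel 'I_n) : nat :=
  \max_(v : 'I_n) degree e v.

Definition no_isolated (n : nat) (e : rel 'I_n) : Prop :=
  forall v : 'I_n, 0 < degree e v.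

Definition contains_copy (m n : nat) (F : rel 'I_m) (G : rel 'I_n) : Prop :=
  exists f : 'I_m -> 'I_n, injective f /\ forall u v, F u v -> G (f u) (f v).

Definition isomorphic (n : nat) (G H : rel 'I_n) : Prop :=
  exists f : 'I_n -> 'I_n, bijective f /\ forall u v, G u v = H (f u) (f v).

(* H_{n,k} = K_{k-1} v (K_{n-k} u K_1): vertices 0..n-2 form a clique, the
   vertex n-1 is adjacent exactly to vertices 0..k-2. *)
Definition Hnk (n k : nat) : rel 'I_n := fun u v =>
  (u != v) &&
  [|| ((u < n.-1) && (v < n.-1))%N,
      ((u == n.-1 :> nat) && (v < k.-1))%N
    | ((v == n.-1 :> nat) && (u < k.-1))%N].

Local Open Scope ring_scope.

Definition adjmx (R : nzRingType) (n : nat) (e : rel 'I_n) : 'M[R]_n :=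
  \matrix_(i, j) (e i j)%:R.

Definition is_spectral_radius (R : realType) (n : nat) (e : rel 'I_n) (l : R) : Prop :=
  eigenvalue (adjmx R e) l /\ forall a : R, eigenvalue (adjmx R e) a -> a <= l.

(* Main.v *)
(** If [lH <= lG] then [n - 2 <= lG], and Stanley's bound
    [lG^2 + lG <= 2 e(G)] leaves at most [n - 1] edges in the complement [C]
    of [G].  When all degrees of [C] are at most [9n/10], [F] and [C] pack:
    the few vertices of large [C]-degree receive independent vertices of [F],
    chosen greedily so that every vertex of [F] sees a limited total
    [C]-degree, and the remaining conflicts are removed by Sauer-Spencer
    swaps.  Otherwise some [v] has degree [d <= n/10] in [G]; comparing
    [A y >= lG y] off [v] shows that [C] has only [O(d^2/n)] edges avoiding
    [v].  If enough neighbours of [v] in [G] meet no such edge, a vertex of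
    minimum degree of [F] is placed on [v], its neighbours on those, and the
    packing is completed as before.  If not, [d] is less than the minimum
    degree [delta] of [F] and [C] has no edge avoiding [v], so [G] is a
    subgraph of [H_(n, delta)], and a positive eigenvector of the latter
    shows that it is not a proper one. *)
Require Import Defs.
From HB Require Import structures.
From mathcomp Require Import all_boot all_order all_algebra all_fingroup.
From mathcomp Require Import reals.
From mathcomp Require Import zify ring lra.
Set Implicit Arguments. Unset Strict Implicit. Unset Printing Implicit Defensive.
Import Order.TTheory GRing.Theory Num.Theory.

(** * Packing *)

Lemma card_nbhd_union (T : finType) (r : rel T) (p : pred T) :
  #|[set z | [exists y, p y && r y z]]| <= \sum_(y | p y) #|[set z | r y z]|.
Proof.
have -> : [set z | [exists y, p y && r y z]]
          = \bigcup_(y | p y) [set z | r y z].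
  apply/setP => z; rewrite inE; apply/existsP/bigcupP.
    by case=> y /andP[py ryz]; exists y; rewrite ?inE.
  by case=> y py; rewrite inE => ryz; exists y; rewrite py.
elim/big_rec2: _ => [|y m B _ le_Bm]; first by rewrite cards0.
by apply: leq_trans (leq_card_setU _ _) _; rewrite leq_add2l.
Qed.

(** By induction on the size of [A :\: B]: a transposition trades an element of [A :\: B] for one of
    [B :\: A]. *)
Lemma perm_into (T : finType) (A B : {set T}) :
  #|A| <= #|B| -> exists f : {perm T}, forall x, x \in A -> f x \in B.
Proof.
move: {2}#|A :\: B| (leqnn #|A :\: B|) => k.
elim: k A => [|k IHk] A leAk leAB.
  exists 1%g => x Ax; rewrite perm1.
  move: leAk; rewrite leqn0 cards_eq0 => /eqP/setP/(_ x).
  by rewrite !inE Ax andbT => /negbT; rewrite negbK.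
have [A0|[x]] := set_0Vmem (A :\: B).
  by apply: IHk => //; rewrite A0 cards0.
rewrite inE => /andP[xNB Ax].
have [y] : exists y, y \in B :\: A.
  apply/set0Pn; rewrite -card_gt0.
  have ABx : 0 < #|A :\: B| by apply/card_gt0P; exists x; rewrite inE xNB.
  have := cardsID B A; have := cardsID A B; rewrite setIC; lia.
rewrite inE => /andP[yNA By].
have yNx : y != x by apply: contraNneq yNA => ->.
pose A' := y |: (A :\ x).
have cA' : #|A'| = #|A|.
  by rewrite cardsU1 !inE (negbTE yNA) andbF (cardsD1 x A) Ax.
have leA'k : #|A' :\: B| <= k.
  have /subset_leq_card : A' :\: B \subset (A :\: B) :\ x.
    apply/subsetP => z; rewrite !inE => /andP[zNB].
    by case: eqP zNB => [->|_ zNB /=]; rewrite ?By // zNB.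
  by move/leq_trans; apply; move: leAk; rewrite (cardsD1 x (A :\: B)) inE xNB Ax.
have [f fA'] := IHk A' leA'k (leq_trans (eq_leq cA') leAB).
exists (tperm x y * f)%g => z Az; rewrite permM.
case: tpermP => [_|zy|zNx zNy].
- by apply: fA'; rewrite setU11.
- by rewrite zy (negbTE yNA) in Az.
by apply: fA'; rewrite !inE Az andbT; apply/orP; right; apply/eqP => zx; apply: zNx.
Qed.

Lemma perm_into_fix (T : finType) (A B : {set T}) (x y : T) :
    #|A| <= #|B| -> x \notin A -> y \notin B ->
  exists f : {perm T}, f x = y /\ forall z, z \in A -> f z \in B.
Proof.
move=> /perm_into[f fAB] xNA yNB.
exists (f * tperm (f x) y)%g; split=> [|z Az]; rewrite permM ?tpermL //.
have Bfz := fAB z Az; rewrite tpermD //; last by apply: contraNneq yNB => ->.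
by apply: contraNneq xNA => /perm_inj->.
Qed.

Lemma sum_perm_seq (T : finType) (f : {perm T}) (s : seq T) (g : T -> nat) :
  uniq s -> \sum_(y | f y \in s) g (f y) = \sum_(a <- s) g a.
Proof.
by move=> us; rewrite big_uniq //= [RHS](reindex_inj (@perm_inj _ f)).
Qed.

(* Greedy choice of the preimage of each [a] in [s]: double counting bounds the
   number of vertices whose load already exceeds [t], so a new preimage
   avoiding their neighbourhoods exists; all other loads grow by at most [D]. *)
Lemma spread_weights (T : finType) (F : rel T) (c : T -> nat)
    (Delta t D C : nat) (Q0 : {set T}) (f0 : {perm T}) (s : seq T) :
    symmetric F -> irreflexive F ->
    (forall x, #|[set y | F x y]| <= Delta) ->
    uniq s -> (forall x, x \in Q0 -> f0 x \notin s) ->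
    (forall a, a \in s -> c a <= D) -> \sum_(a <- s) c a <= C ->
    Delta * (Delta * C) + t * (size s * Delta.+1 + #|Q0|) < t * #|T| ->
  exists f : {perm T},
    [/\ forall x, x \in Q0 -> f x = f0 x,
        forall x y, f x \in s -> f y \in s -> ~~ F x y
      & forall u, \sum_(y | F u y && (f y \in s)) c (f y) <= t + D].
Proof.
move=> Fsym Firr leFD; elim: s => [|a s IHs].
  by exists f0; split=> // u; rewrite big1 // => y; rewrite andbF.
rewrite /= => /andP[sNa us] Q0f0 leD leC lt_tT.
have [||||f [fQ0 find fload]] := IHs us _ _ _ _.
- by move=> x /Q0f0; rewrite inE negb_or => /andP[].
- by move=> b sb; apply: leD; rewrite inE sb orbT.
- by apply: leq_trans leC; rewrite big_cons leq_addl.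
- by apply: leq_ltn_trans lt_tT; rewrite leq_add2l leq_mul2l mulSn -addnA leq_addl orbT.
pose L u := \sum_(y | F u y && (f y \in s)) c (f y).
(* The new preimage has to avoid [Q0], the vertices already placed on [s] ([B1]), their neighbours
   ([B2], for independence), and the neighbours of vertices whose load has reached [t] ([B3]). *)
pose B1 := [set w | f w \in s].
pose B2 := [set w | [exists y, (f y \in s) && F y w]].
pose B3 := [set w | [exists u, (t <= L u) && F u w]].
have cB1 : #|B1| = size s.
  by rewrite cardsE -sum1_card (sum_perm_seq f (fun=> 1) us) sum1_size.
have cB2 : #|B2| <= size s * Delta.
  apply: leq_trans (card_nbhd_union _ _) _.
  apply: leq_trans (leq_sum _ (fun y _ => leFD y)) _.
  by rewrite sum_nat_const -cB1 cardsE.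
have cB3 : #|B3| <= #|[set u | t <= L u]| * Delta.
  apply: leq_trans (card_nbhd_union _ _) _.
  apply: leq_trans (leq_sum _ (fun y _ => leFD y)) _.
  by rewrite sum_nat_const cardsE.
(* A vertex placed on [s] adds its weight to at most [Delta] loads, so the loads total at most
   [Delta * C]. *)
have leL : t * #|[set u | t <= L u]| <= Delta * C.
  have leC' : \sum_(b <- s) c b <= C by apply: leq_trans leC; rewrite big_cons leq_addl.
  rewrite mulnC -sum_nat_const.
  apply: (@leq_trans (\sum_u L u)).
    rewrite [leqRHS](bigID (mem [set u | t <= L u])) /=.
    by apply: leq_trans (leq_addr _ _); apply: leq_sum => u; rewrite inE.
  rewrite /L (exchange_big_dep (fun y => f y \in s)) /=; last first.
    by move=> u y _ /andP[].
  apply: (@leq_trans (\sum_(y | f y \in s) Delta * c (f y))).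
    apply: leq_sum => y fys; rewrite sum_nat_const leq_mul2r; apply/orP; right.
    apply: leq_trans (leFD y); apply/eq_leq; rewrite -[RHS]cardsE.
    by apply: eq_card => u; rewrite !inE unfold_in fys andbT Fsym.
  rewrite (sum_perm_seq f (fun b => Delta * c b) us) -big_distrr /=.
  by rewrite leq_mul2l leC' orbT.
have [w wNB] : exists w, w \notin Q0 :|: B1 :|: B2 :|: B3.
  apply/existsP; apply: contraTT lt_tT => /existsPn allB; rewrite -leqNgt.
  have -> : #|T| = #|Q0 :|: B1 :|: B2 :|: B3|.
    by rewrite -cardsT; apply: eq_card => z; rewrite inE; have:= allB z; rewrite negbK.
  have := (leq_card_setU (Q0 :|: B1 :|: B2) B3).1.
  have := (leq_card_setU (Q0 :|: B1) B2).1.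
  have := (leq_card_setU Q0 B1).1; rewrite cB1 /=.
  move: #|_ :|: B3| => x3; move: #|_ :|: B2| => x2; move: #|_ :|: B1| => x1.
  move: cB2 cB3 leL; move: #|B3| #|B2| #|Q0| #|[set u | t <= L u]| => b3 b2 q h.
  move=> ? ? ? ? ? ?; have: x3 <= q + size s + size s * Delta + h * Delta by lia.
  nia.
rewrite !inE !negb_or -!andbA in wNB.
case/and4P: wNB => wNQ0 fwNs wNB2 wNB3.
pose b := (f^-1)%g a.
have fb : f b = a by rewrite permKV.
(* Neither [a] nor [f w] lies in [s], so the swap disturbs no vertex already placed on [s]. *)
pose f' := (tperm w b * f)%g.
have f'E y : f' y = f (tperm w b y) by rewrite permM.
have f'w : f' w = a by rewrite f'E tpermL.
have f's y : f y \in s -> f' y = f y.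
  move=> fys; rewrite f'E tpermD //; first by apply: contraNneq fwNs => ->.
  by apply: contraNneq sNa => by_; rewrite -fb by_.
have f'in y : (f' y \in a :: s) = (y == w) || (f y \in s).
  rewrite inE -f'w (inj_eq perm_inj); case: eqP => //= /eqP ywN.
  rewrite f'E; case: tpermP => [yw|->|//]; first by rewrite yw eqxx in ywN.
  by rewrite fb (negbTE sNa) (negbTE fwNs).
exists f'; split.
- move=> x Q0x; rewrite f'E tpermD ?fQ0 //.
    by apply: contraNneq wNQ0 => ->.
  by apply/eqP => bx; have := Q0f0 x Q0x; rewrite -fQ0 // -bx fb inE eqxx.
- have wNs y : f y \in s -> ~~ F y w.
    by move=> fys; move/existsPn/(_ y): wNB2; rewrite fys.
  move=> x y; rewrite !f'in => /orP[/eqP->|fx] /orP[/eqP->|fy].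
  + by rewrite Firr.
  + by rewrite Fsym wNs.
  + exact: wNs.
  + exact: find.
move=> u; have [Fuw|FNuw] := boolP (F u w).
  rewrite (bigD1 w) /=; last by rewrite Fuw f'in eqxx.
  have le_ca : c a <= D by apply: leD; rewrite mem_head.
  have ltL : L u < t by move/existsPn/(_ u): wNB3; rewrite Fuw andbT -ltnNge.
  rewrite f'w addnC; apply: leq_add => //; apply: leq_trans (ltnW ltL).
  apply/eq_leq/eq_big => y.
    rewrite f'in; have [->|] := eqVneq y w; last by rewrite andbT.
    by rewrite andbF (negbTE fwNs) andbF.
  by rewrite f'in => /andP[/andP[_ /orP[->//|/f's->]]].
apply: leq_trans (fload u); apply/eq_leq/eq_big => y.
  by rewrite f'in; have [->|//] := eqVneq y w; rewrite (negbTE FNuw).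
rewrite f'in; have [->|_ /andP[_ /f's->//]] := eqVneq y w.
by rewrite (negbTE FNuw).
Qed.

(* Exchanging the image of an end [x] of a conflict with that of a suitable [z]
   destroys the conflict and creates none; [M] bounds the part of the degree sum
   over the neighbours of [x] that comes from the vertices in [s]. *)
Lemma swap_packing (T : finType) (F H : rel T) (Delta r M : nat)
    (Q0 : {set T}) (f0 : {perm T}) (s : seq T) :
    symmetric F -> irreflexive F -> symmetric H ->
    (forall x, #|[set y | F x y]| <= Delta) ->
    uniq s -> (forall a, a \notin s -> #|[set b | H a b]| <= r) ->
    (forall x, x \in Q0 -> forall b, ~~ H (f0 x) b) ->
    #|Q0| + size s + 1 + M + Delta * r + r * Delta < #|T| ->
    forall f : {perm T},
    (forall x, x \in Q0 -> f x = f0 x) ->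
    (forall x y, f x \in s -> f y \in s -> ~~ F x y) ->
    (forall u,
       \sum_(y | F u y && (f y \in s)) #|[set b | H (f y) b]| <= M) ->
  exists g : {perm T},
    (forall x, x \in Q0 -> g x = f0 x)
    /\ forall x y, F x y -> ~~ H (g x) (g y).
Proof.
move=> Fsym Firr Hsym leFD us leHr isoQ0 ltT f.
pose conf (g : {perm T}) :=
  [set p : T * T | F p.1 p.2 && H (g p.1) (g p.2)].
have [k] := ubnP #|conf f|; elim: k f => // k IHk f le_k fQ0 find fload.
have [conf0|[[x0 y0]]] := set_0Vmem (conf f).
  exists f; split=> // x y Fxy; apply/negP => Hxy.
  by have := in_set0 (x, y); rewrite -conf0 inE /= Fxy Hxy.
rewrite inE /= => /andP[Fxy0 Hxy0].
(* The vertices placed on [s] are independent in [F], so a conflict has an end placed outside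
   [s]. *)
have [x [y [Fxy Hxy fxNs]]] :
    exists x, exists y, [/\ F x y, H (f x) (f y) & f x \notin s].
  have [fx|] := boolP (f x0 \in s); last by exists x0, y0.
  exists y0, x0; split; rewrite 1?Fsym 1?Hsym //.
  by apply/negP => fy; have := find _ _ fx fy; rewrite Fxy0.
have xNQ0 : x \notin Q0.
  by apply/negP => Qx; have := isoQ0 x Qx (f y); rewrite -fQ0 // Hxy.
(* After the swap, [x] could clash with a neighbour if [z] were in [B2], and [z] could if it were in
   [B3]. The choice [z = y] is excluded because exchanging both ends keeps the conflict. *)
pose B1 := [set w | f w \in s].
pose B2 := [set z | [exists w, F x w && H (f w) (f z)]].
pose B3 := [set z | [exists u, H (f x) (f u) && F u z]].
have cB1 : #|B1| = size s.
  by rewrite cardsE -sum1_card (sum_perm_seq f (fun=> 1) us) sum1_size.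
have cH w : #|[set z | H w (f z)]| = #|[set b | H w b]|.
  rewrite -(card_imset _ (@perm_inj _ f)); apply: eq_card => b.
  rewrite inE; apply/imsetP/idP => [[z]|Hwb]; first by rewrite inE => ? ->.
  by exists ((f^-1)%g b); rewrite ?inE permKV.
have cB2 : #|B2| <= M + Delta * r.
  apply: leq_trans (card_nbhd_union _ _) _.
  rewrite (eq_bigr _ (fun w _ => cH (f w))) (bigID (fun w => f w \in s)) /=.
  apply: leq_add; first exact: fload.
  apply: (@leq_trans (\sum_(w | F x w) r)).
    rewrite [leqRHS](bigID (fun w => f w \in s)) /=.
    apply: leq_trans (leq_addl _ _).
    by apply: leq_sum => w /andP[_ /leHr].
  rewrite sum_nat_const leq_mul2r; apply/orP; right.
  by apply: leq_trans (leFD x); rewrite cardsE.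
have cB3 : #|B3| <= r * Delta.
  apply: leq_trans (card_nbhd_union _ _) _.
  apply: leq_trans (leq_sum _ (fun u _ => leFD u)) _.
  rewrite sum_nat_const leq_mul2r; apply/orP; right.
  by apply: leq_trans (leHr _ fxNs); rewrite -cH cardsE.
have [z zNB] : exists z, z \notin Q0 :|: B1 :|: [set y] :|: B2 :|: B3.
  apply/existsP; apply: contraTT ltT => /existsPn allB; rewrite -leqNgt.
  have -> : #|T| = #|Q0 :|: B1 :|: [set y] :|: B2 :|: B3|.
    by rewrite -cardsT; apply: eq_card => z; rewrite inE; have:= allB z; rewrite negbK.
  have := (leq_card_setU (Q0 :|: B1 :|: [set y] :|: B2) B3).1.
  have := (leq_card_setU (Q0 :|: B1 :|: [set y]) B2).1.
  have := (leq_card_setU (Q0 :|: B1) [set y]).1; rewrite cards1.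
  have := (leq_card_setU Q0 B1).1; rewrite cB1 /=.
  move: #|_ :|: B3| => x3; move: #|_ :|: B2| => x2.
  move: #|_ :|: [set y]| => x1; move: #|_ :|: B1| => x0'.
  move: cB2 cB3; move: #|B3| #|B2| #|Q0| => b3 b2 q; lia.
rewrite !inE !negb_or -!andbA in zNB.
case/and5P: zNB => zNQ0 fzNs zNy zNB2 zNB3.
pose f' := (tperm x z * f)%g.
have f'E w : f' w = f (tperm x z w) by rewrite permM.
have f's w : (f' w \in s) = (f w \in s).
  by rewrite f'E; case: tpermP => // ->; rewrite (negbTE fxNs) (negbTE fzNs).
have f's_eq w : f w \in s -> f' w = f w.
  move=> fws; rewrite f'E tpermD //; first by apply: contraNneq fxNs => ->.
  by apply: contraNneq fzNs => ->.
have clash2 w : F x w -> ~~ H (f z) (f w).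
  by move=> Fxw; move/existsPn/(_ w): zNB2; rewrite Fxw Hsym.
have clash3 w : F z w -> ~~ H (f x) (f w).
  by move=> Fzw; move/existsPn/(_ w): zNB3; rewrite Fsym Fzw andbT.
apply: (IHk f').
(* After the swap no pair meeting [x] or [z] is in conflict, except possibly [x] and [z] together,
   whose status is unchanged by symmetry of [H]. The conflict [(x, y)] disappears. *)
- rewrite -ltnS; apply: leq_trans le_k; apply/proper_card/properP; split.
    apply/subsetP => -[p q]; rewrite !inE /= => /andP[Fpq].
    rewrite Fpq !f'E /=.
    case: tpermP => [px|pz|/eqP pNx /eqP pNz].
    + subst p; case: tpermP => [qx|qz|_ _].
      * by rewrite qx Firr in Fpq.
      * by rewrite qz Hsym.
      * by rewrite (negbTE (clash2 q Fpq)).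
    + subst p; case: tpermP => [qx|qz|_ _].
      * by rewrite qx Hsym.
      * by rewrite qz Firr in Fpq.
      * by rewrite (negbTE (clash3 q Fpq)).
    case: tpermP => [qx|qz|//].
      by rewrite Hsym qx (negbTE (clash2 p _)) // Fsym -qx.
    by rewrite Hsym qz (negbTE (clash3 p _)) // Fsym -qz.
  exists (x, y); rewrite !inE /= Fxy //= !f'E tpermL.
  rewrite tpermD //; first exact: clash2.
  by apply: contraTneq Fxy => ->; rewrite Firr.
- move=> w Qw; rewrite f'E tpermD ?fQ0 //.
    by apply: contraNneq xNQ0 => ->.
  by apply: contraNneq zNQ0 => ->.
- by move=> u w; rewrite !f's; apply: find.
move=> u; apply: leq_trans (fload u); apply/eq_leq/eq_big => w.
  by rewrite f's.
by case/andP => _; rewrite f's => /f's_eq->.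
Qed.

(** Here [r] is the integer square root of [n = #|T|]. Independent vertices go on the set [s] of
    vertices of [H]-degree above [r], with loads at most [t + D], about [37n/40]. The two swap terms
    [Delta * r] cost at most [n/40] each, and [Q0] and [s] fit into the last [n/40]. *)
Lemma packing (T : finType) (F H : rel T) (Delta r : nat)
    (Q0 : {set T}) (f0 : {perm T}) :
    symmetric F -> irreflexive F -> symmetric H ->
    (forall x, #|[set y | F x y]| <= Delta) ->
    40 * Delta <= r -> 200 <= r -> r * r <= #|T| -> #|T| < r.+1 * r.+1 ->
    \sum_a #|[set b | H a b]| <= 2 * #|T| ->
    (forall a, 10 * #|[set b | H a b]| <= 9 * #|T|) ->
    (forall x, x \in Q0 -> forall b, ~~ H (f0 x) b) -> #|Q0| <= Delta.+1 ->
  exists g : {perm T},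
    (forall x, x \in Q0 -> g x = f0 x)
    /\ forall x y, F x y -> ~~ H (g x) (g y).
Proof.
move=> Fsym Firr Hsym leFD le_Dr le_r le_rn lt_nr sumH leH isoQ0 leQ0.
pose n := #|T|; rewrite -/n in le_rn lt_nr sumH leH *.
pose dH a := #|[set b | H a b]|.
pose s := enum [set a | r < dH a].
pose t := n %/ 40; pose D := (9 * n) %/ 10.
have us : uniq s := enum_uniq _.
have sNr a : a \notin s -> dH a <= r by rewrite mem_enum inE -leqNgt.
have sum_s : \sum_(a <- s) dH a <= 2 * n.
  apply: leq_trans sumH; rewrite big_enum /= [leqRHS](bigID (mem [set a | r < dH a])) /=.
  exact: leq_addr.
(* Degrees in [s] exceed [r] and total at most [2n], where [n < (r + 1)^2]. *)
have le_k : size s <= 2 * r + 5.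
  have : size s * r <= 2 * n.
    apply: leq_trans sum_s; rewrite -cardE -sum_nat_const big_enum /=.
    by apply: leq_sum => a; rewrite inE => /ltnW.
  move: (size s) => k le_kr; rewrite leqNgt; apply/negP => lt_k.
  by have := leq_mul lt_k (leqnn r); lia.
have le_rr : 200 * r <= n by apply: leq_trans le_rn; rewrite leq_mul2r le_r orbT.
have le_DD : 40 * (Delta * r) <= n by have := leq_mul le_Dr (leqnn r); lia.
have le_DD2 : 1600 * (Delta * Delta) <= n by have := leq_mul le_Dr le_Dr; lia.
have le_t : n < 40 * t + 40 /\ 40 * t <= n by rewrite /t; lia.
have le_D : 10 * D <= 9 * n by rewrite /D; lia.
have le_kq : 16 * (size s * Delta.+1 + #|Q0|) <= n.
  have := leq_mul le_k (leqnn Delta.+1).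
  have : 40 * Delta.+1 <= r + 40 by lia.
  move/(leq_mul (leqnn (2 * r + 6))); lia.
have le_nr : 200 * 200 <= n by lia.
(* The first term is at most [n^2/800] and the second at most [t * n/16], while [t >= n/41]. *)
have ltD : Delta * (Delta * (2 * n)) + t * (size s * Delta.+1 + #|Q0|) < t * n.
  move: (_ + #|Q0|) le_kq => m /(leq_mul (leqnn t)) le_m.
  have := leq_mul le_DD2 (leqnn n).
  have : n <= 41 * t by lia.
  move/leq_mul/(_ (leqnn n)).
  have : 0 < n * n by rewrite muln_gt0; lia.
  lia.
have [x Qx||f [fQ0 find fload]] :=
    @spread_weights T F dH Delta t D (2 * n) Q0 f0 s Fsym Firr leFD us _ _ sum_s ltD.
- rewrite mem_enum inE -leqNgt (_ : dH _ = 0) //.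
  by apply: eq_card0 => b; rewrite inE; apply: negbTE (isoQ0 x Qx b).
- by move=> a _; rewrite /D; have := leH a; rewrite -/(dH a); lia.
apply: (@swap_packing T F H Delta r (t + D) Q0 f0 s _ _ _ _ _ _ _ _ f) => //.
by rewrite -/n; lia.
Qed.

Local Open Scope ring_scope.

(** * Spectral bounds on the complement *)

(** In the complement of [e], the vertex [v] is made isolated rather than deleted, so that the
    result is still a relation on [T] to which [packing] applies. *)
Definition coedge_off (T : finType) (v : T) (e : rel T) : rel T :=
  fun z w => [&& z != v, w != v, z != w & ~~ e z w].

Lemma card_set_sum (T : finType) (p : pred T) :
  #|[set w | p w]| = (\sum_w p w)%N.
Proof.
rewrite cardsE -sum1_card big_mkcond; apply: eq_bigr => w _.
by rewrite unfold_in; case: (p w).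
Qed.

Lemma sum_cond_le (R : numDomainType) (T : finType) (y : T -> R) (M : R)
    (p : pred T) :
  (forall w, y w <= M) -> \sum_(w | p w) y w <= #|[set w | p w]|%:R * M.
Proof.
move=> leM; apply: le_trans (ler_sum _ (fun w _ => leM w)) _.
by rewrite cardsE mulr_natl sumr_const.
Qed.

Lemma sum_cond_sub (R : numDomainType) (T : finType) (y : T -> R)
    (p q : pred T) :
    (forall w, 0 <= y w) -> (forall w, p w -> q w) ->
  \sum_(w | p w) y w <= \sum_(w | q w) y w.
Proof.
move=> y0 pq; rewrite [leRHS](bigID p) /= (eq_bigl p).
  by rewrite lerDl; apply: sumr_ge0.
by move=> w; case pw: (p w); rewrite ?andbT ?andbF // pq.
Qed.

(** The 2 counts [z] and [v]; the term [e z v] corrects for [v] being counted twice when it is a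
    neighbour of [z]. *)
Lemma deg_coedge_off (T : finType) (e : rel T) (v z : T) :
    irreflexive e -> z != v ->
  (#|[set w | e z w]| + #|[set w | coedge_off v e z w]| + 2
    = #|T| + e z v)%N.
Proof.
move=> eirr zNv; rewrite !card_set_sum -cardsT card_set_sum.
have s1 (a : T) : (\sum_w (w == a))%N = 1%N by rewrite -card_set_sum cardsE card1.
have -> : (2 = (\sum_w (w == z)) + \sum_w (w == v))%N by rewrite !s1.
have -> : (nat_of_bool (e z v) = \sum_w (if w == v then e z v else false))%N.
  by rewrite (bigD1 v) //= eqxx big1 ?addn0 // => w /negbTE->.
rewrite -!big_split /=; apply: eq_bigr => w _; rewrite /coedge_off zNv /=.
rewrite [z == w]eq_sym; have [->|wNv] := eqVneq w v.
  by rewrite [v == z]eq_sym (negbTE zNv) /=; lia.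
by have [->|wNz] := eqVneq w z; rewrite ?eirr //=; case: (e z w).
Qed.

(* Apply the inequality twice at a maximal coordinate [u]: row [u] of
   [A^2 + A] sums to at most the total degree. *)
Lemma sum_deg_lower (R : realFieldType) (T : finType) (e : rel T) (y : T -> R)
    (lam : R) :
    irreflexive e -> (forall w, 0 <= y w) ->
    (forall z, lam * y z <= \sum_(w | e z w) y w) ->
    (exists z, 0 < y z) -> (1 : R) <= #|T|%:R - 1 <= lam + 1 ->
  ((#|T| - 1) * (#|T| - 2) <= \sum_z #|[set w | e z w]|)%N.
Proof.
move=> eirr y0 ley [z0 yz0] /andP[n1 nlam].
pose d z := #|[set w | e z w]|.
case: (arg_maxP y (isT : xpredT z0)) => u _ maxu.
have M0 : 0 < y u by apply: lt_le_trans yz0 (maxu z0 isT).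
have leM w : y w <= y u by apply: maxu.
have lam0 : 0 <= lam by lra.
have le1 : lam * y u <= (d u)%:R * y u by apply: le_trans (ley u) (sum_cond_le _ leM).
have le2 : lam * (lam * y u) <= (\sum_(z | e u z) d z)%N%:R * y u.
  apply: (@le_trans _ _ (\sum_(z | e u z) lam * y z)).
    by rewrite -mulr_sumr ler_wpM2l.
  rewrite natr_sum mulr_suml; apply: ler_sum => z _.
  by apply: le_trans (ley z) (sum_cond_le _ leM).
have le3 : lam * (lam + 1) <= (\sum_z d z)%N%:R.
  rewrite -(ler_pM2r M0).
  apply: (@le_trans _ _ ((\sum_(z | e u z) d z)%N%:R * y u + (d u)%:R * y u)); first by lra.
  rewrite -mulrDl -natrD ler_wpM2r ?(ltW M0) // ler_nat.
  (* As [u] is not its own neighbour, [d u] is a term of the total separate from those of the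
     neighbours. *)
  rewrite [leqRHS](bigID (e u)) /= leq_add2l (bigD1 u) ?eirr //=.
  exact: leq_addr.
rewrite -(ler_nat R); apply: le_trans le3.
have n2 : (2 <= #|T|)%N by rewrite -(ler_nat R); lra.
by rewrite natrM !natrB ?(ltnW n2) //; nra.
Qed.

(* Summing the eigenvalue inequality for [y' = A y] over [z != v] gives
   [\sum_z h z * y' z <= d * y' v], while [y'] is almost constant off [v]. *)
Lemma coedges_off_upper (R : realFieldType) (T : finType) (e : rel T)
    (y : T -> R) (lam : R) (v : T) :
    symmetric e -> irreflexive e -> (forall w, 0 <= y w) ->
    (forall z, lam * y z <= \sum_(w | e z w) y w) ->
    (exists z, 0 < y z) -> (1 : R) <= #|T|%:R - 1 <= lam + 1 ->
    let d := #|[set w | e v w]| in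
    let m2 := (\sum_z #|[set w | coedge_off v e z w]|)%N in
  (m2 <= 2 * d)%N /\ (m2 * #|T| <= d * d + m2 * (4 + 2 * d))%N.
Proof.
move=> esym eirr y0 ley yn0 nlam d m2.
have sumd := sum_deg_lower eirr y0 ley yn0 nlam.
move: yn0 nlam => [z0 yz0] /andP[n1 nlam].
pose h z := #|[set w | coedge_off v e z w]|.
have n2 : (2 <= #|T|)%N by rewrite -(ler_nat R); lra.
have hv : h v = 0%N by apply: eq_card0 => w; rewrite inE /coedge_off eqxx.
have degh z : z != v -> (#|[set w | e z w]| + h z + 2 = #|T| + e z v)%N.
  exact: deg_coedge_off.
have m2E : m2 = (\sum_(z | z != v) h z)%N by rewrite /m2 (bigD1 v) //= -/(h v) hv.
have sum_ev : (\sum_(z | z != v) e z v = d)%N.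
  rewrite /d card_set_sum [RHS](bigD1 v) //= eirr add0n.
  by apply: eq_bigr => z _; rewrite esym.
have cardN : #|[set z | z != v]| = (#|T| - 1)%N.
  by rewrite subn1 -(cardsC1 v); apply: eq_card => z; rewrite !inE.
(* Sum the degree identity over [z != v]; by [sumd] the degrees off [v] total at least
   [(n - 1)(n - 2) - d]. *)
have le_m2 : (m2 <= 2 * d)%N.
  have : (\sum_(z | z != v) (#|[set w | e z w]| + h z + 2) = \sum_(z | z != v) (#|T| + e z v))%N.
    by apply: eq_bigr => z /degh.
  rewrite !big_split /= !sum_nat_const sum_ev -m2E -[X in (_ + X * 2)%N]cardsE.
  rewrite -[X in (X * #|T| + _)%N]cardsE cardN.
  move: sumd; rewrite (bigD1 v) //= -/d; nia.
split=> //.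
case: (arg_maxP y (isT : xpredT z0)) => u _ maxu.
have M0 : 0 < y u by apply: lt_le_trans yz0 (maxu z0 isT).
have leM w : y w <= y u by apply: maxu.
have lam0 : 0 <= lam by lra.
pose y' z := \sum_(w | e z w) y w.
have y'0 z : 0 <= y' z by apply: sumr_ge0.
have ley' z : lam * y' z <= \sum_(w | e z w) y' w.
  by rewrite mulr_sumr; apply: ler_sum.
have y'v : y' v <= d%:R * y u by apply: sum_cond_le.
have sumy : (#|T|%:R - 3) * y u <= \sum_(w | w != v) y w.
  have : lam * y u <= \sum_w y w by apply: le_trans (ley u) (sum_cond_sub _ _).
  by rewrite (bigD1 v) //=; have := leM v; nra.
(* Among the vertices other than [v], the sum [y' z] misses only [z] and [h z] others, each worth at
   most [y u]. *)
have y'lo z : z != v -> (#|T|%:R - 4 - (h z)%:R) * y u <= y' z.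
  move=> zNv; move: sumy; rewrite (bigID (e z)) /=.
  have : \sum_(w | (w != v) && e z w) y w <= y' z.
    by apply: sum_cond_sub => // w /andP[].
  have := @sum_cond_le _ _ y (y u) [pred w | (w != v) && ~~ e z w] leM.
  have -> : #|[set w | (w != v) && ~~ e z w]| = (h z).+1.
    rewrite /h (cardsD1 z) !inE zNv eirr add1n; congr _.+1.
    by apply: eq_card => w; rewrite !inE /coedge_off zNv [z == w]eq_sym; do 2!case: (_ == _).
  by rewrite -natr1 /=; lra.
(* Exchanging sums gives each [y' w] with [w != v] the coefficient [n - 2 - h w], and [y' v] the
   coefficient [d]. As [lam >= n - 2], the terms in [n - 2] are absorbed on the left. *)
have key : \sum_(z | z != v) (h z)%:R * y' z <= d%:R * y' v.
  have : lam * (\sum_(z | z != v) y' z)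
         <= \sum_w #|[set z | (z != v) && e z w]|%:R * y' w.
    rewrite mulr_sumr; apply: le_trans (ler_sum _ (fun z _ => ley' z)) _.
    rewrite (exchange_big_dep xpredT) //=; apply: ler_sum => w _.
    by rewrite cardsE mulr_natl sumr_const.
  rewrite [X in _ <= X](bigD1 v) //=.
  have -> : #|[set z | (z != v) && e z v]| = d.
    apply: eq_card => z; rewrite !inE esym.
    by have [->|] := eqVneq z v; rewrite ?eirr.
  have -> : \sum_(w | w != v) #|[set z | (z != v) && e z w]|%:R * y' w
      = (#|T|%:R - 2) * (\sum_(z | z != v) y' z) - \sum_(z | z != v) (h z)%:R * y' z.
    rewrite mulr_sumr -sumrB; apply: eq_bigr => w wNv; rewrite -mulrBl.
    congr (_ * _).
    have : (#|[set z | (z != v) && e z w]| + h w + 2 = #|T|)%N.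
      have := degh w wNv; rewrite (cardsD1 v) inE.
      rewrite (_ : #|_ :\ v| = #|[set z | (z != v) && e z w]|); first by lia.
      by apply: eq_card => z; rewrite !inE esym.
    by move/(congr1 (fun k => k%:R : R)); rewrite !natrD; lra.
  have : (#|T|%:R - 2) * (\sum_(z | z != v) y' z) <= lam * (\sum_(z | z != v) y' z).
    by rewrite ler_wpM2r ?sumr_ge0 //; lra.
  lra.
have le_hm z : z != v -> (h z <= 2 * d)%N.
  by move=> zNv; apply: leq_trans le_m2; rewrite m2E (bigD1 z) //= leq_addr.
have : m2%:R * ((#|T|%:R - 4 - (2 * d)%N%:R) * y u) <= d%:R * (d%:R * y u).
  apply: le_trans (le_trans key _); last by rewrite ler_wpM2l.
  rewrite m2E natr_sum mulr_suml; apply: ler_sum => z zNv.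
  rewrite ler_wpM2l //; apply: le_trans (y'lo z zNv); rewrite ler_pM2r //.
  by rewrite lerB // ler_nat le_hm.
rewrite !mulrA ler_pM2r // => le_R.
rewrite -(ler_nat R) natrD !natrM natrD natrM.
by move: le_R; rewrite natrM; lra.
Qed.

(** * Eigenvectors of graphs *)

Lemma eigenvalue_adjmxP (R : fieldType) (n : nat) (e : rel 'I_n) (a : R) :
    symmetric e ->
  eigenvalue (adjmx R e) a <->
  exists2 y : 'I_n -> R,
    (forall u, \sum_(w | e u w) y w = a * y u) & exists u, y u != 0.
Proof.
move=> esym.
have mulE (x : 'rV[R]_n) u :
    (x *m adjmx R e) 0 u = \sum_(w | e u w) x 0 w.
  rewrite mxE [RHS]big_mkcond; apply: eq_bigr => w _; rewrite mxE esym.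
  by case: (e u w); rewrite ?mulr1 ?mulr0.
split=> [/eigenvalueP[x xE x0]|[y yE [u0 yu0]]].
  exists (x 0); first by move=> u; rewrite -mulE xE mxE.
  by case/rV0Pn: x0 => u xu; exists u.
apply/eigenvalueP; exists (\row_u y u); last by apply/rV0Pn; exists u0; rewrite mxE.
apply/rowP => u; rewrite mulE !mxE -yE.
by apply: eq_bigr => w _; rewrite mxE.
Qed.

Lemma isomorphic_sym (n : nat) (G H : rel 'I_n) :
  isomorphic G H -> isomorphic H G.
Proof.
case=> f [[g fK gK] GH]; exists g; split; first by exists f.
by move=> u v; rewrite GH !gK.
Qed.

Lemma isomorphic_eigenvalue (R : fieldType) (n : nat) (G H : rel 'I_n) (a : R) :
    symmetric G -> symmetric H -> isomorphic G H ->
  eigenvalue (adjmx R G) a -> eigenvalue (adjmx R H) a.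
Proof.
move=> Gsym Hsym [f [[g fK gK] GH]] /(eigenvalue_adjmxP _ Gsym)[y yE [u yu]].
apply/(eigenvalue_adjmxP _ Hsym); exists (y \o g); last by exists (f u); rewrite /= fK.
move=> w /=; rewrite -yE (reindex f) /=; last by exists g => x _.
by apply: eq_big => x; rewrite ?fK // GH gK.
Qed.

Lemma isomorphic_spectral_radius (R : realType) (n : nat) (G H : rel 'I_n)
    (lG lH : R) :
    symmetric G -> symmetric H -> isomorphic G H ->
  is_spectral_radius G lG -> is_spectral_radius H lH -> lG = lH.
Proof.
move=> Gsym Hsym GH [eG maxG] [eH maxH]; apply/eqP; rewrite eq_le; apply/andP.
split; [apply: maxH; exact: isomorphic_eigenvalue eG |].
by apply: maxG; apply: isomorphic_eigenvalue (isomorphic_sym GH) eH.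
Qed.

(** Absolute values of an eigenvector suffice, by the triangle inequality. The estimates on [G] use
    only this inequality, which replaces a Perron eigenvector. *)
Lemma eigenvalue_subvector (R : realFieldType) (n : nat) (e : rel 'I_n) (a : R) :
    symmetric e -> 0 <= a -> eigenvalue (adjmx R e) a ->
  exists y : 'I_n -> R, [/\ forall u, 0 <= y u,
    forall u, a * y u <= \sum_(w | e u w) y w & exists u, 0 < y u].
Proof.
move=> esym a0 /(eigenvalue_adjmxP _ esym)[x xE [u xu]].
exists (fun w => `|x w|); split=> //; last by exists u; rewrite normr_gt0.
by move=> w; rewrite -{1}(ger0_norm a0) -normrM -xE ler_norm_sum.
Qed.

(** * Cliques with one additional vertex *)

(** A copy of [Hnk] with [k - 1 = #|K|] whose apex [v] and attachment set [K] are free, so that both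
    can be read off from [G]. *)
Definition clique_plus (T : finType) (v : T) (K : {set T}) : rel T := fun u w =>
  (u != w) &&
  [|| (u != v) && (w != v), (u == v) && (w \in K) | (w == v) && (u \in K)].

Lemma clique_plus_sym (T : finType) (v : T) (K : {set T}) :
  symmetric (clique_plus v K).
Proof.
move=> u w; rewrite /clique_plus [w == u]eq_sym [(w != v) && _]andbC.
by rewrite [((w == v) && _) || _]orbC.
Qed.

Lemma sum_clique_plus_apex (V : nmodType) (T : finType) (v : T) (K : {set T})
    (y : T -> V) :
  v \notin K -> \sum_(w | clique_plus v K v w) y w = \sum_(w in K) y w.
Proof.
move=> vNK; apply: eq_bigl => w; rewrite /clique_plus eqxx (negbTE vNK) /= andbF orbF.
by have [<-|] := eqVneq v w; rewrite ?(negbTE vNK).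
Qed.

Lemma sum_clique_plus (R : zmodType) (T : finType) (v u : T) (K : {set T})
    (y : T -> R) :
    u != v ->
  \sum_(w | clique_plus v K u w) y w
    = \sum_(w | w != v) y w - y u + (if u \in K then y v else 0).
Proof.
move=> uNv; rewrite [in RHS](bigD1 u) //= (addrC (y u)) addrK.
rewrite (bigID (pred1 v)) /= addrC; congr (_ + _).
  apply: eq_bigl => w; rewrite /clique_plus uNv (negbTE uNv) /=.
  by rewrite eq_sym; case: (w == u); case: (w == v); case: (u \in K).
have [uK|uNK] := boolP (u \in K).
  rewrite (big_pred1 v) // => w; rewrite /clique_plus uNv (negbTE uNv) uK /=.
  by have [->|] := eqVneq w v; rewrite ?andbF // uNv.
rewrite big1 // => w; rewrite /clique_plus uNv (negbTE uNv) (negbTE uNK) /= andbF.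
by case/andP=> /andP[_ /orP[|//]] /[swap] ->.
Qed.

(* [a], [b], [c] are the values of an eigenvector on [K] (of size [p]), on the
   rest of the clique, and at the apex; eliminating [b] and [c] makes [mu] a
   root of a cubic that changes sign on [[n - 2, n - 1]]. *)
Lemma clique_plus_quotient_root (R : rcfType) (n p : nat) : (p + 2 <= n)%N ->
  exists mu a b c : R,
    [/\ n%:R - 2 <= mu, 0 < b,
        mu * b = p%:R * a + (n%:R - 2 - p%:R) * b, mu * c = p%:R * a
      & (0 < p)%N -> [/\ 0 < a, 0 < c
        & mu * a = (p%:R - 1) * a + (n%:R - 1 - p%:R) * b + c]].
Proof.
move=> le_pn; have [->|p_gt0] := posnP p.
  (* Here the apex is isolated: the constant vector on the clique, extended by 0. *)
  exists (n%:R - 2), 0, 1, 0; split=> //; lra.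
have pR : 1 <= p%:R :> R by rewrite ler1n.
have nR : p%:R + 2 <= n%:R :> R by rewrite -[2]/(2%:R) -natrD ler_nat.
set P : R := p%:R in pR nR *; set N : R := n%:R in nR *.
(* The characteristic polynomial of the 3 by 3 quotient matrix. *)
pose q : {poly R} := ('X - (P - 1)%:P) * 'X * ('X - (N - P - 2)%:P)
   - (N - 1 - P)%:P * P%:P * 'X - P%:P * ('X - (N - P - 2)%:P).
have qE x : q.[x] = (x - (P - 1)) * x * (x - (N - P - 2))
   - (N - 1 - P) * P * x - P * (x - (N - P - 2)).
  by rewrite /q !hornerE.
have [||mu] := @poly_ivt R q (N - 2) (N - 1); first by lra.
  by apply/andP; rewrite !qE; split; nra.
move=> /andP[mu1 mu2] /rootP; rewrite qE => mu0.
(* The equations for [b] and [c] with denominators cleared; the one for [a] is then a multiple of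
   [q.[mu] = 0]. *)
exists mu, (mu * (mu - (N - P - 2))), (P * mu), (P * (mu - (N - P - 2))).
have mu_gt0 : 0 < mu by lra.
have be_gt0 : 0 < mu - (N - P - 2) by lra.
have P_gt0 : 0 < P by lra.
split=> //; [exact: mulr_gt0 | ring | ring | move=> _].
split; [exact: mulr_gt0 | exact: mulr_gt0 | nra].
Qed.

(** The quotient solution is made constant on each of the three classes. Positivity needs [K]
    nonempty, since an isolated apex gets the value 0. *)
Lemma clique_plus_eigenvector (R : rcfType) (T : finType) (v : T) (K : {set T}) :
    v \notin K -> (#|K| + 2 <= #|T|)%N ->
  exists mu (y : T -> R),
    [/\ #|T|%:R - 2 <= mu,
        forall u, \sum_(w | clique_plus v K u w) y w = mu * y u,
        exists u, y u != 0
      & (0 < #|K|)%N -> forall u, 0 < y u].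
Proof.
move=> vNK leK; have [mu [a [b [c [mu_ge b_gt0 muE cE aE]]]]] :=
  @clique_plus_quotient_root R _ _ leK.
pose y u := if u == v then c else if u \in K then a else b.
have yK u : u \in K -> y u = a.
  by move=> uK; rewrite /y uK; case: eqP uK vNK => // -> ->.
have yb u : u != v -> u \notin K -> y u = b.
  by move=> /negbTE uNv /negbTE uNK; rewrite /y uNv uNK.
have yv : y v = c by rewrite /y eqxx.
have sumK : \sum_(w in K) y w = #|K|%:R * a.
  by rewrite (eq_bigr _ yK) sumr_const mulr_natl.
have cardKC : #|[set w | (w != v) && (w \notin K)]| = (#|T| - 1 - #|K|)%N.
  have -> : [set w | (w != v) && (w \notin K)] = ~: (v |: K).
    by apply/setP => w; rewrite !inE negb_or.
  by have := cardsC (v |: K); rewrite cardsU1 vNK /=; lia.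
have sumT : \sum_(w | w != v) y w = #|K|%:R * a + (#|T|%:R - 1 - #|K|%:R) * b.
  rewrite (bigID (mem K)) /= -sumK; congr (_ + _).
    by apply: eq_bigl => w; case: eqP vNK => // ->; case: (v \in K).
  rewrite (eq_bigr (fun=> b)); last by move=> w /andP[]; apply: yb.
  rewrite -[#|T|%:R - 1 - _](_ : (#|T| - 1 - #|K|)%:R = _); last first.
    by rewrite !natrB //; lia.
  by rewrite -cardKC cardsE mulr_natl sumr_const.
exists mu, y; split=> //.
- move=> u; have [->|uNv] := eqVneq u v.
    by rewrite sum_clique_plus_apex // sumK yv cE.
  rewrite sum_clique_plus // sumT yv; have [uK|uNK] := boolP (u \in K).
    have K_gt0 : (0 < #|K|)%N by apply/card_gt0P; exists u.
    have [_ _ aE'] := aE K_gt0.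
    by rewrite yK // aE'; ring.
  by rewrite yb // muE; ring.
- have /card_gt0P[u] : (0 < #|[set w | (w != v) && (w \notin K)]|)%N.
    by rewrite cardKC; lia.
  by rewrite inE => /andP[uNv uNK]; exists u; rewrite yb // gt_eqF.
by move=> /aE[a_gt0 c_gt0 _] u; rewrite /y; case: ifP => // _; case: ifP.
Qed.

(* Pair the subsolution of the smaller graph with the positive eigenvector of
   the larger one; an extra neighbour [j] of the apex makes this strict. *)
Lemma clique_plus_lt (R : realFieldType) (T : finType) (v : T) (N K : {set T})
    (lam mu : R) (y z : T -> R) :
    v \notin K -> N \proper K -> 0 < lam ->
    (forall u, 0 < y u) ->
    (forall u, \sum_(w | clique_plus v K u w) y w = mu * y u) ->
    (forall u, 0 <= z u) -> (exists u, 0 < z u) ->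
    (forall u, lam * z u <= \sum_(w | clique_plus v N u w) z w) ->
  lam < mu.
Proof.
move=> vNK /properP[sNK [j jK jNN]] lam0 y0 yE z0 zn0 zE.
have vNN : v \notin N by apply: contra vNK; apply: (subsetP sNK).
have jNv : j != v by apply: contraNneq vNK => <-.
(* Unlike [z], its image [z'] is certainly positive at [j]: were [z' j = 0], then [z] would vanish
   at [j], on the rest of the clique, and finally at [v]. *)
pose z' u := \sum_(w | clique_plus v N u w) z w.
have z'0 u : 0 <= z' u by apply: sumr_ge0.
have z'E u : lam * z' u <= \sum_(w | clique_plus v N u w) z' w.
  by rewrite mulr_sumr; apply: ler_sum.
have z'j : 0 < z' j.
  rewrite lt0r z'0 andbT; apply/eqP => z'j0.
  have eq0 u : lam * z u <= 0 -> z u = 0.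
    by rewrite pmulr_rle0 // => zu; apply/eqP; rewrite eq_le zu z0.
  have zj : z j = 0 by apply: eq0; rewrite -z'j0.
  have sum0 : \sum_(w | w != v) z w = 0.
    by move: z'j0; rewrite /z' sum_clique_plus // zj (negbTE jNN) subr0 addr0.
  have zw w : w != v -> z w = 0 by apply: (psumr_eq0P _ sum0).
  have zv : z v = 0.
    apply: eq0; apply: le_trans (zE v) _; rewrite sum_clique_plus_apex //.
    rewrite big1 // => w wN; apply: zw.
    by apply: contraNneq vNN => <-.
  by case: zn0 => u; have [->|/zw->] := eqVneq u v; rewrite ?zv ltxx.
have le_y u : \sum_(w | clique_plus v N u w) y w <= mu * y u.
  rewrite -yE; apply: sum_cond_sub => [w|w]; first exact: ltW.
  rewrite /clique_plus => /andP[-> /or3P[->//|/andP[-> /(subsetP sNK)->]|]].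
    by rewrite orbT.
  by case/andP=> -> /(subsetP sNK)->; rewrite !orbT.
have lt_y : \sum_(w | clique_plus v N j w) y w < mu * y j.
  by rewrite -yE !sum_clique_plus // jK (negbTE jNN) addr0 ltrDl.
(* Move the adjacency of the smaller graph from [z'] to [y] by symmetry; at [j] the positive term
   [y v] is lost. *)
have lt_sum : lam * (\sum_u z' u * y u) < mu * (\sum_u z' u * y u).
  apply: (@le_lt_trans _ _ (\sum_u y u * \sum_(w | clique_plus v N u w) z' w)).
    rewrite mulr_sumr; apply: ler_sum => u _.
    by rewrite mulrA mulrC ler_wpM2l // ltW.
  have -> : \sum_u y u * \sum_(w | clique_plus v N u w) z' w
      = \sum_w z' w * \sum_(u | clique_plus v N w u) y u.
    under eq_bigr do rewrite mulr_sumr.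
    rewrite (exchange_big_dep xpredT) //=; apply: eq_bigr => w _.
    rewrite mulr_sumr; apply: eq_big => [u|u _]; first by rewrite clique_plus_sym.
    by rewrite mulrC.
  rewrite mulr_sumr (bigD1 j) //= [ltRHS](bigD1 j) //=.
  apply: ltr_leD; first by rewrite mulrCA ltr_pM2l.
  by apply: ler_sum => w _; rewrite mulrCA ler_wpM2l.
have sum_gt0 : 0 < \sum_u z' u * y u.
  rewrite (bigD1 j) //= ltr_wpDr ?mulr_gt0 // sumr_ge0 // => u _.
  by rewrite mulr_ge0 // ltW.
by move: lt_sum; rewrite ltr_pM2r.
Qed.

Lemma clique_plus_isomorphic (n : nat) (v v' : 'I_n) (K K' : {set 'I_n}) :
    v \notin K -> v' \notin K' -> #|K| = #|K'| ->
  isomorphic (clique_plus v K) (clique_plus v' K').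
Proof.
move=> vNK v'NK' eqK.
have [f [fv fK]] := perm_into_fix (eq_leq eqK) vNK v'NK'.
have fKE : f @: K = K'.
  apply/eqP; rewrite eqEcard card_imset ?eqK ?leqnn ?andbT; last exact: perm_inj.
  by apply/subsetP => _ /imsetP[x /fK ? ->].
have memf w : (f w \in K') = (w \in K) by rewrite -fKE mem_imset //; apply: perm_inj.
exists f; split; first by exists (f^-1)%g; [apply: permK | apply: permKV].
by move=> u w; rewrite /clique_plus -fv !(inj_eq perm_inj) !memf.
Qed.

Lemma Hnk_clique_plus (n k : nat) (n_gt0 : (n.-1 < n)%N) :
    (k.-1 <= n.-1)%N ->
  let v0 := Ordinal n_gt0 in let K0 := [set i : 'I_n | (i < k.-1)%N] in
  [/\ v0 \notin K0, #|K0| = k.-1 & @Hnk n k =2 clique_plus v0 K0].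
Proof.
move=> lek v0 K0; split.
- by rewrite inE /= -leqNgt.
- have le_kn : (k.-1 <= n)%N by lia.
  have winj : injective (widen_ord le_kn).
    by move=> i j /(congr1 val) /= ij; apply: val_inj.
  rewrite -[RHS]card_ord -(card_imset _ winj).
  apply: eq_card => i; rewrite inE; apply/idP/imsetP => [lti|[j _ ->]].
    by exists (Ordinal lti) => //; apply: val_inj.
  by rewrite /= ltn_ord.
move=> u w; rewrite /Hnk /clique_plus !inE; congr (_ && _).
have ltE (x : 'I_n) : (x < n.-1)%N = (x != v0).
  by rewrite -val_eqE /=; have := ltn_ord x; lia.
by rewrite !ltE -!val_eqE.
Qed.

(** * Copy-free graphs of large spectral radius *)

Lemma min_degree_le (n : nat) (e : rel 'I_n) (v : 'I_n) :
  (min_degree e <= degree e v)%N.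
Proof.
rewrite /min_degree; have := mem_index_enum v.
elim: (index_enum _) => // u s IHs; rewrite inE big_cons => /orP[/eqP->|/IHs].
  exact: geq_minl.
by apply: leq_trans; apply: geq_minr.
Qed.

Lemma min_degree_attained (n : nat) (e : rel 'I_n) :
  (0 < n)%N -> exists v, (degree e v <= min_degree e)%N.
Proof.
move=> n_gt0; rewrite /min_degree; elim/big_rec: _ => [|u x _ [v lev]].
  (* The starting value [n] of the minimum bounds every degree. *)
  by exists (Ordinal n_gt0); rewrite -[leqRHS]card_ord max_card.
case: (leqP (degree e u) x) => [leu|ltx]; first by exists u.
by exists v.
Qed.

Lemma nat_sqrt_exists (n : nat) : exists r, (r * r <= n < r.+1 * r.+1)%N.
Proof.
elim: n => [|n [r /andP[le_rn lt_nr]]]; first by exists 0%N.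
have [lt_n|le_n] := ltnP n.+1 (r.+1 * r.+1); first by exists r; rewrite lt_n leqW.
by exists r.+1; rewrite le_n /= (leq_ltn_trans lt_nr) //; lia.
Qed.

Lemma deg_coedge (T : finType) (e : rel T) (z : T) :
    irreflexive e ->
  (#|[set w | e z w]| + #|[set w | (z != w) && ~~ e z w]| + 1 = #|T|)%N.
Proof.
move=> eirr; have s1 : (\sum_w (z == w))%N = 1%N.
  by rewrite -card_set_sum -(cards1 z); apply: eq_card => w; rewrite !inE eq_sym.
rewrite !card_set_sum -cardsT card_set_sum -s1 -!big_split /=.
by apply: eq_bigr => w _; have [<-|_] := eqVneq z w; rewrite ?eirr //=; case: (e z w).
Qed.

Lemma coedge_off_sym (T : finType) (v : T) (e : rel T) :
  symmetric e -> symmetric (coedge_off v e).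
Proof.
move=> esym u w; rewrite /coedge_off esym [w == u]eq_sym.
by case: (u == v); case: (w == v).
Qed.

Lemma packing_contains (n : nat) (F G : rel 'I_n) (g : {perm 'I_n}) :
  (forall x y, F x y -> G (g x) (g y)) -> contains_copy F G.
Proof. by move=> FG; exists g; split=> //; apply: perm_inj. Qed.

(** A packing of [F] with the complement of [G] is a copy of [F] in [G]; the structure is what
    remains when neither use of [packing] is possible. *)
Lemma copy_free_structure (R : realFieldType) (n r : nat) (F G : rel 'I_n)
    (lam : R) (y : 'I_n -> R) :
    simple_graph F -> simple_graph G -> ~ contains_copy F G ->
    (40 * max_degree F <= r)%N -> (200 <= r)%N -> (r * r <= n < r.+1 * r.+1)%N ->
    (forall w, 0 <= y w) ->
    (forall z, lam * y z <= \sum_(w | G z w) y w) ->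
    (exists z, 0 < y z) -> n%:R - 2 <= lam ->
  exists v, (#|[set u | G v u]| < min_degree F)%N
    /\ G =2 clique_plus v [set u | G v u].
Proof.
move=> [Fsym Firr] [Gsym Girr] nocopy leDr le_r /andP[le_rn lt_nr] y0 yG yn0 le_lam.
set Delta := max_degree F in leDr *.
have leFD x : (#|[set w | F x w]| <= Delta)%N by apply: (leq_bigmax x).
have cT : #|'I_n| = n := card_ord n.
have n_big : (200 * 200 <= n)%N by apply: leq_trans le_rn; apply: leq_mul.
have nlam : (1 : R) <= #|'I_n|%:R - 1 <= lam + 1.
  have : 2%:R <= n%:R :> R by rewrite ler_nat; lia.
  by rewrite cT => n2; apply/andP; split; lra.
have sumG := sum_deg_lower Girr y0 yG yn0 nlam.
have sum_co : (\sum_a #|[set b | (a != b) && ~~ G a b]| <= 2 * n)%N.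
  have : (\sum_(a : 'I_n) (#|[set w | G a w]| + #|[set w | (a != w) && ~~ G a w]| + 1)
          = \sum_(a : 'I_n) n)%N.
    by apply: eq_bigr => a _; rewrite deg_coedge.
  rewrite !big_split /= !sum_nat_const cT; move: sumG; rewrite cT.
  move: (\sum_z _)%N (\sum_z _)%N => s1 s2.
  by case: (n) n_big => [|[|m]] //; lia.
have [all_small|] :=
  boolP [forall a, 10 * #|[set b | (a != b) && ~~ G a b]| <= 9 * n]%N.
  case: nocopy.
  have cosym : symmetric (fun a b => (a != b) && ~~ G a b).
    by move=> a b; rewrite eq_sym Gsym.
  have [||||||g [_ gFG]] := @packing _ F (fun a b => (a != b) && ~~ G a b) Delta r
      set0 1%g Fsym Firr cosym leFD leDr le_r; rewrite ?cT ?cards0 //.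
  - by move=> a; apply: (forallP all_small).
  - by move=> x; rewrite inE.
  apply: (packing_contains (g := g)) => x w Fxw; have := gFG x w Fxw.
  rewrite negb_and !negbK => /orP[/eqP/perm_inj xw|//].
  by rewrite xw Firr in Fxw.
case/forallPn => v; rewrite -ltnNge => big_v.
have degv := deg_coedge v Girr; rewrite cT in degv.
set d := #|[set u | G v u]| in degv.
have le_d : (10 * d <= n)%N by lia.
have [] := coedges_off_upper v Gsym Girr y0 yG yn0 nlam; rewrite -/d cT.
pose H := coedge_off v G; pose h z := #|[set w | H z w]|.
rewrite -/H; set m2 := (\sum_z _)%N => le_m2 le_m2n.
have le_hm z : (h z <= m2)%N by rewrite /m2 (bigD1 z) //= leq_addr.
have [w0 le_w0] : exists w, (degree F w <= min_degree F)%N.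
  by apply: min_degree_attained; lia.
(* Images in [I] are adjacent to [v] and isolated in [H], so they may be fixed in advance: [w0] goes
   to [v] and its neighbours into [I], and only coedges off [v] remain to be avoided. *)
pose I := [set u | G v u & h u == 0%N].
have lt_I : (#|I| < degree F w0)%N.
  rewrite ltnNge; apply/negP => le_FI; apply: nocopy.
  have w0NA : w0 \notin [set u | F w0 u] by rewrite inE Firr.
  have vNI : v \notin I by rewrite inE Girr.
  have [f0 [f0w f0I]] := perm_into_fix le_FI w0NA vNI.
  have [||||||g [gQ gFH]] := @packing _ F H Delta r (w0 |: [set u | F w0 u]) f0
    Fsym Firr (coedge_off_sym v Gsym) leFD leDr le_r; rewrite ?cT //.
  - by rewrite -/m2; lia.
  - by move=> a; have := le_hm a; rewrite /h; lia.
  - move=> x; rewrite in_setU1 => /orP[/eqP-> b|/f0I + b].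
      by rewrite f0w /H /coedge_off eqxx.
    rewrite inE => /andP[_ /eqP/cards0_eq/setP/(_ b)].
    by rewrite !inE => ->.
  - by rewrite cardsU1 w0NA add1n ltnS.
  have gw0 : g w0 = v by rewrite gQ ?setU11.
  have apex x : F w0 x -> G v (g x).
    move=> Fx; have Ax : x \in [set u | F w0 u] by rewrite inE.
    by rewrite gQ ?inE ?Fx ?orbT //; have := f0I x Ax; rewrite inE => /andP[].
  apply: (packing_contains (g := g)) => x z Fxz; have := gFH x z Fxz.
  rewrite /H /coedge_off !negb_and !negbK -gw0 !(inj_eq perm_inj).
  case/or4P => [/eqP xw|/eqP zw|/eqP xz|//].
  - by rewrite xw gw0; apply: apex; rewrite -xw.
  - by rewrite zw gw0 Gsym; apply: apex; rewrite -zw Fsym.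
  - by rewrite xz Firr in Fxz.
(* Each neighbour of [v] outside [I] contributes at least 1 to [m2]. *)
have le_dI : (d <= #|I| + m2)%N.
  have /subset_leq_card le1 : [set u | G v u] \subset I :|: [set u | h u != 0%N].
    by apply/subsetP => u; rewrite !inE => ->; case: (h u == 0%N).
  apply: leq_trans le1 _; apply: leq_trans (leq_card_setU _ _).1 _.
  rewrite leq_add2l card_set_sum; apply: leq_sum => u _.
  by rewrite -/(h u); case: (h u).
(* If [m2 > 0], then [3 m2 n / 4 <= d^2] with [d <= n/10] gives [30 m2 <= 4 d]. Hence
   [26 d <= 30 Delta], so [d^2] is far below [3n/4], a contradiction. *)
have m20 : m2 = 0%N.
  have lt_dD : (d < Delta + m2)%N.
    by have := leFD w0; have := lt_I; rewrite /degree; lia.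
  apply/eqP; rewrite -leqn0 leqNgt; apply/negP => m2_gt0.
  have le4 : (m2 * (4 * (4 + 2 * d)) <= m2 * n)%N by apply: leq_mul => //; lia.
  have le30 : (30 * m2 <= 4 * d)%N.
    have : (n * (30 * m2) <= n * (4 * d))%N.
      by have := leq_mul (leqnn d) le_d; lia.
    by rewrite leq_pmul2l //; lia.
  have le_n : (n <= m2 * n)%N by rewrite leq_pmull.
  have lt26 : (26 * d <= 30 * Delta)%N by lia.
  have := leq_mul lt26 lt26; have := leq_mul leDr leDr; lia.
exists v; split; first by rewrite m20 addn0 in le_dI; lia.
have noH a b : H a b = false.
  have : h a = 0%N by have := le_hm a; rewrite m20 leqn0 => /eqP.
  by move/cards0_eq/setP/(_ b); rewrite !inE.
move=> a b; rewrite /clique_plus !inE.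
have [<-|aNb] := eqVneq a b; first by rewrite Girr.
have [->|aNv] := eqVneq a v; first by rewrite Girr andbF orbF.
have [->|bNv] := eqVneq b v; first by rewrite Gsym.
by have := noH a b; rewrite /H /coedge_off aNv bNv aNb /= => /negbFE.
Qed.

Lemma isomorphic_of_spectral_radius_ge (R : realType) (n : nat)
    (F G : rel 'I_n) (lG lH : R) :
    (200 * 200 <= n)%N -> simple_graph F -> simple_graph G ->
    (max_degree F)%:R <= Num.sqrt (n%:R : R) / 40 ->
    ~ contains_copy F G ->
    is_spectral_radius G lG ->
    is_spectral_radius (@Hnk n (min_degree F)) lH ->
  lH <= lG -> isomorphic G (@Hnk n (min_degree F)).
Proof.
move=> n_big Fsimple Gsimple leD nocopy [eG _] [_ maxH] le_lHG.
have le_D2 : ((40 * max_degree F) * (40 * max_degree F) <= n)%N.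
  rewrite -(ler_nat R) -[leRHS](@sqr_sqrtr R n%:R) // expr2 natrM.
  by apply: ler_pM; rewrite ?ler0n // natrM; lra.
have [r /andP[le_rn lt_nr]] := nat_sqrt_exists n.
have leDr : (40 * max_degree F <= r)%N.
  by rewrite leqNgt; apply/negP => lt_r; have := leq_mul lt_r lt_r; lia.
have le_r : (200 <= r)%N.
  by rewrite leqNgt; apply/negP => lt_r; have := leq_mul lt_r lt_r; lia.
set k := min_degree F in maxH *.
have le_200r : (200 * r <= n)%N by apply: leq_trans le_rn; rewrite leq_mul2r le_r orbT.
have n_gt0 : (0 < n)%N by lia.
have le_k : (k <= max_degree F)%N.
  by apply: leq_trans (min_degree_le F (Ordinal n_gt0)) _; apply: leq_bigmax.
have pn : (n.-1 < n)%N by lia.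
have [] := @Hnk_clique_plus n k pn; first by lia.
set v0 := Ordinal pn; set K0 := [set i | _] => v0K cardK0 HE.
have Hsym : symmetric (@Hnk n k) by move=> a b; rewrite !HE clique_plus_sym.
(* Every such graph is a copy of [Hnk], so [lH] bounds its eigenvalues wherever its apex lies. *)
have ge_lH (v : 'I_n) (K : {set 'I_n}) : v \notin K -> #|K| = k.-1 ->
    exists mu (y : 'I_n -> R), [/\ n%:R - 2 <= mu <= lH,
        forall u, \sum_(w | clique_plus v K u w) y w = mu * y u
      & (0 < #|K|)%N -> forall u, 0 < y u].
  move=> vK cardK; have [|mu [y [mu_ge yE yn0 y_gt0]]] :=
    @clique_plus_eigenvector R _ v K vK; first by rewrite card_ord cardK; lia.
  rewrite card_ord in mu_ge; exists mu, y; split=> //; rewrite mu_ge /=; apply: maxH.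
  apply: (@isomorphic_eigenvalue _ _ (clique_plus v K)) => //.
  - exact: clique_plus_sym.
  - have [f [fbij fE]] := clique_plus_isomorphic vK v0K (etrans cardK (esym cardK0)).
    by exists f; split=> // a b; rewrite HE fE.
  by apply/eigenvalue_adjmxP; [exact: clique_plus_sym | exists y].
have le_lG : n%:R - 2 <= lG.
  by have [mu [y [/andP[mu_ge mu_le] _ _]]] := ge_lH _ _ v0K cardK0; lra.
have n2 : 2%:R < n%:R :> R by rewrite ltr_nat; lia.
have lG_gt0 : 0 < lG by lra.
have [y [y0 yG yn0]] := eigenvalue_subvector Gsimple.1 (ltW lG_gt0) eG.
have le_lt : (r * r <= n < r.+1 * r.+1)%N by rewrite le_rn.
have [v [lt_v GE]] :=
  copy_free_structure Fsimple Gsimple nocopy leDr le_r le_lt y0 yG yn0 le_lG.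
set N := [set u | G v u] in lt_v GE; rewrite -/k in lt_v.
have vNN : v \notin N by rewrite inE Gsimple.2.
have leN : (#|N| <= k.-1)%N by rewrite -ltnS (ltn_predK lt_v).
have [eqN|neN] := eqVneq #|N| k.-1.
  have [f [fbij fE]] := clique_plus_isomorphic vNN v0K (etrans eqN (esym cardK0)).
  by exists f; split=> // a b; rewrite HE GE fE.
(* Otherwise [N] is too small; enlarging it to size [k - 1] strictly raises the spectral bound,
   against [lH <= lG]. *)
have [K [NK vK cardK]] : exists K : {set 'I_n},
    [/\ N \proper K, v \notin K & #|K| = k.-1].
  have [f [fv fN]] : exists f : {perm 'I_n},
      f v = v0 /\ forall u, u \in N -> f u \in K0.
    by apply: perm_into_fix => //; rewrite cardK0.
  have cardf : #|f @^-1: K0| = k.-1.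
    rewrite -cardK0 on_card_preimset //; apply: onW_bij.
    by exists (f^-1)%g; [apply: permK | apply: permKV].
  exists (f @^-1: K0); split=> //; last by rewrite inE fv.
  rewrite properEcard cardf ltn_neqAle neN leN !andbT.
  by apply/subsetP => u uN; rewrite inE fN.
have [mu [x [/andP[_ mu_le] xE x_gt0]]] := ge_lH v K vK cardK.
have K_gt0 : (0 < #|K|)%N by apply: leq_ltn_trans (proper_card NK).
have : lG < mu.
  apply: (@clique_plus_lt _ _ v N K lG mu x y) => //; first exact: x_gt0.
  move=> u; apply: le_trans (yG u) _.
  by rewrite (eq_bigl _ _ (GE u)).
by rewrite ltNge (le_trans mu_le le_lHG).
Qed.

Theorem theorem1p4 :
  exists n0 : nat, forall (R : realType) (n : nat), (n0 <= n)%N ->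
  forall (F G : rel 'I_n),
    simple_graph F -> simple_graph G ->
    no_isolated F ->
    (max_degree F)%:R <= Num.sqrt (n%:R : R) / 40 ->
    ~ contains_copy F G ->
    forall lG lH : R,
      is_spectral_radius G lG ->
      is_spectral_radius (@Hnk n (min_degree F)) lH ->
      lG <= lH /\ (lG = lH <-> isomorphic G (@Hnk n (min_degree F))).
Proof.
(* This makes the integer square root of [n] at least 200, as [packing] requires. *)
exists (200 * 200)%N => R n n_big F G Fs Gs _ leD nocopy lG lH sG sH.
have iso := isomorphic_of_spectral_radius_ge n_big Fs Gs leD nocopy sG sH.
have Hsym : symmetric (@Hnk n (min_degree F)).
  move=> u w; rewrite /Hnk eq_sym [(_ < n.-1)%N && _]andbC; congr (_ && (_ || _)).
  exact: orbC.
have eq_iso GH := isomorphic_spectral_radius Gs.1 Hsym GH sG sH.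
split; last by split=> [eqGH|//]; apply: iso; rewrite eqGH.
rewrite leNgt; apply/negP => lt_lHG.
by have := eq_iso (iso (ltW lt_lHG)); move: lt_lHG => /[swap] ->; rewrite ltxx.
Qed.
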